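(* Let $p,q\ge0$, $s\in\mathcal{Y}_p$, $t\in\mathcal{Y}_q$ and $r\in\mathcal{Y}_{p+q}$. In $\mathcal{Y}Sym$, the coefficient of $M_r$ in the product $M_s\cdot M_t$ equals the number of $\zeta\in\mathfrak{S}^{(p,q)}$ such that the set $\{(s',t')\in\mathcal{Y}_p\times\mathcal{Y}_q : f_\zeta(s',t')\le r\}$ has a maximum element (for the product of Tamari orders) and this maximum equals $(s,t)$.
   Context: Permutations are in one-line notation; products are compositions of functions. $\mathrm{st}(a_1,\dots,a_p)\in\mathfrak{S}_p$ is the permutation with the same relative order as distinct integers $a_1,\dots,a_p$. For $\sigma\in\mathfrak{S}_p,\tau\in\mathfrak{S}_q$: $\sigma\vee\tau\in\mathfrak{S}_{p+q+1}$ is $\sigma(1)+q,\dots,\sigma(p)+q,p+q+1,\tau(1),\dots,\tau(q)$ and $\sigma/\tau\in\mathfrak{S}_{p+q}$ is $\sigma(1),\dots,\sigma(p),\tau(1)+p,\dots,\tau(q)+p$. $\mathfrak{S}^{(p,q)}$ is the set of $\zeta\in\mathfrak{S}_{p+q}$ with at most one descent, at position $p$ (i.e. $\zeta(i)>\zeta(i+1)$ implies $i=p$). Trees: $\mathcal{Y}_n$ is the set of rooted planar binary trees with $n$ internal nodes; $\mathcal{Y}_0=\{|\}$; $s\vee t$ is the tree with left subtree $s$ and right subtree $t$ at its root, each $t\neq|$ is uniquely $t_l\vee t_r$. Tamari order: generated by replacing a subtree $(a\vee b)\vee c$ by the larger $a\vee(b\vee c)$. $\lambda:\mathfrak{S}_n\to\mathcal{Y}_n$: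 $\lambda(\mathrm{id}_0)=|$, and for $j=\sigma^{-1}(n)$, $\lambda(\sigma)=\lambda(\mathrm{st}(\sigma(1),\dots,\sigma(j-1)))\vee\lambda(\mathrm{st}(\sigma(j+1),\dots,\sigma(n)))$. $\gamma:\mathcal{Y}_n\to\mathfrak{S}_n$: $\gamma(|)=\mathrm{id}_0$, $\gamma(t)=\gamma(t_l)\vee\gamma(t_r)$. For $\zeta\in\mathfrak{S}^{(p,q)}$, $f_\zeta:\mathcal{Y}_p\times\mathcal{Y}_q\to\mathcal{Y}_{p+q}$ is $f_\zeta(s,t)=\lambda\big((\gamma(s)/\gamma(t))\cdot\zeta^{-1}\big)$. $\mathcal{Y}Sym$: graded Hopf algebra over $\mathbb{Q}$ with basis $F_t$. Leaves of $t\in\mathcal{Y}_p$ are numbered $0,\dots,p$. Splitting $t$ at leaf $i$, $t\to(t_0,t_1)$: $|\to(|,|)$; for $t=t_l\vee t_r$, if leaf $i$ is in $t_l$ and $t_l\to(a,b)$ there, then $t\to(a,b\vee t_r)$; if in $t_r$ and $t_r\to(c,d)$, then $t\to(t_l\vee c,d)$ (the left piece has leaves $0,\dots,i$ of $t$). For a multiset $i_1\le\dots\le i_q$ of leaves of $t$, the division $t\to(t_0,\dots,t_q)$ is obtained by splitting $t$ at $i_q$ into $(t',t_q)$ and dividing $t'$ at $i_1,\dots,i_{q-1}$ (for $q=0$ the division is $(t)$). For $s\in\mathcal{Y}_q$ with leaves numbered $0,\dots,q$, $(t_0,\dots,t_q)/s$ is obtained by grafting the root of $t_i$ onto leaf $i$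 of $s$. Product: $F_t\cdot F_s=\sum F_{(t_0,\dots,t_q)/s}$, summed over the $\binom{p+q}{q}$ multisets. Coproduct: $\Delta(F_t)=\sum_{i}F_{t_0}\otimes F_{t_1}$ over splittings. Monomial basis $M_t=\sum_{t\le s}\mu_{\mathcal{Y}_n}(t,s)F_s$ (Möbius function of the Tamari order). *)

(* Defs.v *)
(* Planar binary trees, Tamari order, Möbius function,
   the product of YSym in the F basis, the M basis, and the maps
   lambda, gamma, f_zeta on permutations (one-line notation as seq nat,
   values 1..n). *)
From Stdlib Require Import Relations ClassicalEpsilon.
From HB Require Import structures.
From mathcomp Require Import all_boot all_order all_algebra.
Set Implicit Arguments. Unset Strict Implicit. Unset Printing Implicit Defensive.
Import GRing.Theory.

Inductive tree := Leaf | Node of tree & tree.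

Fixpoint tree_eqb (a b : tree) : bool :=
  match a, b with
  | Leaf, Leaf => true
  | Node a1 a2, Node b1 b2 => tree_eqb a1 b1 && tree_eqb a2 b2
  | _, _ => false
  end.

Lemma tree_eqP : Equality.axiom tree_eqb.
Proof.
elim=> [|a1 IH1 a2 IH2] [|b1 b2] /=; try by constructor.
case: (IH1 b1) => [->|H]; last by constructor; case.
case: (IH2 b2) => [->|H]; last by constructor; case.
by constructor.
Qed.

HB.instance Definition _ := hasDecEq.Build tree tree_eqP.

Fixpoint nodes (t : tree) : nat :=
  match t with Leaf => 0 | Node l r => (nodes l + nodes r).+1 end.

Fixpoint treesUpTo (n : nat) : seq (seq tree) :=
  match n with
  | 0 => [:: [:: Leaf]]
  | n'.+1 =>
      let L := treesUpTo n' in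
      rcons L (flatten [seq [seq Node l r | l <- nth [::] L i, r <- nth [::] L (n' - i)]
                          | i <- iota 0 n'.+1])
  end.

Definition Y (n : nat) : seq tree := nth [::] (treesUpTo n) n.

Fixpoint rot1 (t : tree) : seq tree :=
  match t with
  | Leaf => [::]
  | Node l r =>
      (if l is Node a b then [:: Node a (Node b r)] else [::])
      ++ [seq Node l' r | l' <- rot1 l] ++ [seq Node l r' | r' <- rot1 r]
  end.

Definition rot_step (t u : tree) : Prop := u \in rot1 t.

Definition tamari_le (t u : tree) : Prop := clos_refl_trans tree rot_step t u.

Definition tamari_leb (t u : tree) : bool :=
  if excluded_middle_informative (tamari_le t u) then true else false.

(* mu(x,x) = 1, mu(x,y) = - sum_{x <= z < y} mu(x,z) for x < y, 0 otherwise.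
   The recursion is run with fuel; fuel #|Y_n|+1 exceeds the length of any chain. *)
Fixpoint mob_aux (k : nat) (Yn : seq tree) (x y : tree) : rat :=
  match k with
  | 0 => 0%R
  | k'.+1 =>
      if x == y then 1%R
      else if tamari_leb x y then
        (- \sum_(z <- Yn | tamari_leb x z && tamari_leb z y && (z != y)) mob_aux k' Yn x z)%R
      else 0%R
  end.

Definition mobius (x y : tree) : rat :=
  mob_aux (size (Y (nodes x))).+1 (Y (nodes x)) x y.

(* splitting t at leaf i (leaves numbered 0..nodes t) *)
Fixpoint split_at (t : tree) (i : nat) : tree * tree :=
  match t with
  | Leaf => (Leaf, Leaf)
  | Node l r =>
      if i <= nodes l then
        let: (a, b) := split_at l i in (a, Node b r)
      else
        let: (c, d) := split_at r (i - (nodes l).+1) in (Node l c, d)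
  end.

(* division of t at the multiset given in DECREASING order [:: i_q; ...; i_1] *)
Fixpoint divide (t : tree) (rl : seq nat) : seq tree :=
  match rl with
  | [::] => [:: t]
  | i :: rl' => let: (t', tq) := split_at t i in rcons (divide t' rl') tq
  end.

Fixpoint graft_aux (s : tree) (ts : seq tree) : tree * seq tree :=
  match s with
  | Leaf => (head Leaf ts, behead ts)
  | Node l r =>
      let: (l', ts1) := graft_aux l ts in
      let: (r', ts2) := graft_aux r ts1 in (Node l' r', ts2)
  end.

Definition graft (ts : seq tree) (s : tree) : tree := (graft_aux s ts).1.

(* multisets of size q of {0..hi}, each listed as a non-increasing sequence *)
Fixpoint msets (q hi : nat) : seq (seq nat) :=
  match q with
  | 0 => [:: [::]]
  | q'.+1 => flatten [seq [seq i :: l | l <- msets q' i] | i <- iota 0 hi.+1]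
  end.

(* coefficient of F_u in F_t . F_s *)
Definition Fprod_coef (t s u : tree) : rat :=
  ((count (fun m => graft (divide t m) s == u) (msets (nodes s) (nodes t)))%:R)%R.

(* coefficient of F_u in M_s . M_t, where M_x = sum_{x <= y} mu(x,y) F_y *)
Definition Mprod_Fcoef (s t u : tree) : rat :=
  (\sum_(s' <- Y (nodes s) | tamari_leb s s')
    \sum_(t' <- Y (nodes t) | tamari_leb t t')
      mobius s s' * mobius t t' * Fprod_coef s' t' u)%R.

(* coefficient of F_u in sum_{r in Y_n} c(r) M_r *)
Definition Mcomb_Fcoef (n : nat) (c : tree -> rat) (u : tree) : rat :=
  (\sum_(r <- Y n | tamari_leb r u) c r * mobius r u)%R.

Definition st (a : seq nat) : seq nat := [seq (count (fun y => y < x) a).+1 | x <- a].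

Fixpoint lam_aux (k : nat) (s : seq nat) : tree :=
  match k with
  | 0 => Leaf
  | k'.+1 =>
      if s is [::] then Leaf else
      let j := index (size s) s in
      Node (lam_aux k' (st (take j s))) (lam_aux k' (st (drop j.+1 s)))
  end.
Definition lam (s : seq nat) : tree := lam_aux (size s) s.

Definition pvee (sg tau : seq nat) : seq nat :=
  [seq x + size tau | x <- sg] ++ (size sg + size tau).+1 :: tau.
Definition pslash (sg tau : seq nat) : seq nat :=
  sg ++ [seq x + size sg | x <- tau].

Fixpoint gam (t : tree) : seq nat :=
  match t with Leaf => [::] | Node l r => pvee (gam l) (gam r) end.

Definition pcomp (sg tau : seq nat) : seq nat := [seq nth 0 sg j.-1 | j <- tau].
Definition pinv (z : seq nat) : seq nat := [seq (index i z).+1 | i <- iota 1 (size z)].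

Definition f_zeta (z : seq nat) (s t : tree) : tree :=
  lam (pcomp (pslash (gam s) (gam t)) (pinv z)).

Definition is_shuffle_perm (p q : nat) (z : seq nat) : bool :=
  perm_eq z (iota 1 (p + q)) &&
  all (fun i => (nth 0 z i.+1 < nth 0 z i) ==> (i.+1 == p)) (iota 0 (p + q).-1).

Definition Spq (p q : nat) : seq (seq nat) :=
  [seq z <- permutations (iota 1 (p + q)) | is_shuffle_perm p q z].

Definition max_is (p q : nat) (z : seq nat) (r s t : tree) : bool :=
  tamari_leb (f_zeta z s t) r &&
  all (fun s' => all (fun t' => tamari_leb (f_zeta z s' t') r ==>
                                  (tamari_leb s' s && tamari_leb t' t)) (Y q)) (Y p).

(* Main.v *)
(** Identify a tree with its bracket vector, the sizes of the right subtrees of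
    its nodes read in in-order; the Tamari order is then the pointwise order.
    Replace a shuffle [zeta] by the 0/1 word [m] marking the positions of the
    letters of [gam t] in [(gam s / gam t) zeta^-1]. The bracket vector of
    [f_zeta z s t] is computed letter by letter from [m]: a letter of [s] keeps
    its bracket, cut at the next letter of [t], and a letter of [t] absorbs every
    letter up to the next larger letter of [t]. Hence [f_zeta z s t <= r] amounts
    to separate upper bounds on the brackets of [s] and of [t] (plus a condition
    on [m] and [r] only), and these bounds are themselves bracket vectors: so
    [{(s, t) | f_zeta z s t <= r}] is empty or a principal ideal. As
    [F_s F_t] is the sum of the [F_(f_zeta z s t)], Moebius inversion then turns
    the coefficient of [M_r] in [M_s M_t] into the stated count. *)

Require Import Defs.
From Stdlib Require Import Relations ClassicalEpsilon.
From mathcomp Require Import all_boot all_order all_algebra.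
From mathcomp Require Import zify.
Set Implicit Arguments. Unset Strict Implicit. Unset Printing Implicit Defensive.
Import GRing.Theory.

(** * Bracket vectors and the Tamari order *)

Fixpoint br (t : tree) : seq nat :=
  if t is Node l r then br l ++ nodes r :: br r else [::].

Lemma size_br t : size (br t) = nodes t.
Proof. by elim: t => //= l IHl r IHr; rewrite size_cat /= IHl IHr addnS. Qed.

(* Validity: an entry [a] spans the next [a] positions, and spans are nested. *)
Fixpoint bvalid (v : seq nat) : bool :=
  if v is a :: v' then
    [&& a <= size v', all (fun i => i + nth 0 v' i < a) (iota 0 a) & bvalid v']
  else true.

Lemma bvalid_lt v i : bvalid v -> i < size v -> i + nth 0 v i < size v.
Proof.
elim: v i => //= a v IH [|i] /and3P[le_a _ vv] /=; first by rewrite add0n ltnS.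
by rewrite !ltnS addSn => /(IH _ vv).
Qed.

Lemma bvalid_cat u v : bvalid u -> bvalid v -> bvalid (u ++ v).
Proof.
elim: u => //= a u IH /and3P[le_a /allP au vu] vv; rewrite IH // andbT.
rewrite size_cat (leq_trans le_a) ?leq_addr //=.
apply/allP => i i_in; rewrite nth_cat; have := au i i_in.
by move: i_in; rewrite mem_iota add0n => /leq_trans->.
Qed.

Lemma bvalid_cons_size v : bvalid v -> bvalid (size v :: v).
Proof.
move=> vv /=; rewrite leqnn vv andbT; apply/allP => i.
by rewrite mem_iota => /bvalid_lt->.
Qed.

Lemma bvalid_br t : bvalid (br t).
Proof.
elim: t => //= l IHl r IHr.
by apply: bvalid_cat => //; rewrite -size_br; apply: bvalid_cons_size.
Qed.

Lemma bvalid_drop n v : bvalid v -> bvalid (drop n v).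
Proof. by elim: v n => [|a v IH] [|n] //= /and3P[_ _]; apply: IH. Qed.

Lemma bvalid_take n v :
  bvalid v -> (forall i, i < n -> i + nth 0 v i < n) -> bvalid (take n v).
Proof.
elim: v n => [|a v IH] [|n] //= /and3P[le_a /allP av vv] H.
have le_an : a <= n by have := H 0; rewrite add0n ltnS; apply.
rewrite IH // ?andbT; last by move=> i lt_i; have /= := H i.+1 lt_i; rewrite addSn ltnS.
rewrite size_take_min leq_min le_an le_a; apply/allP => i i_in.
by rewrite nth_take ?av //; move: i_in; rewrite mem_iota add0n => /leq_trans->.
Qed.

(* [x] grafted on the leftmost leaf of [t] (Loday and Ronco's [x / t]). *)
Fixpoint over (x t : tree) : tree := if t is Node l r then Node (over x l) r else x.

Lemma br_over x t : br (over x t) = br x ++ br t.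
Proof. by elim: t => [|l IHl r _] /=; rewrite ?cats0 // IHl catA. Qed.

(** No bracket crosses position [i], so the cut runs along the left spine: if [i] lies beyond the
    left subtree, the bracket of the root reaches the end and forces [i] to be the whole size. *)
Lemma over_split t i :
  i <= nodes t -> (forall j, j < i -> j + nth 0 (br t) j < i) ->
  exists t1 t2, t = over t1 t2 /\ nodes t1 = i.
Proof.
elim: t i => [|l IHl r _] i /= le_i H.
  by exists Leaf, Leaf; move: le_i; rewrite leqn0 => /eqP->.
have [le_il | lt_li] := leqP i (nodes l).
  have [j lt_j|t1 [l2 [-> <-]]] := IHl i le_il; last by exists t1, (Node l2 r).
  by have := H j lt_j; rewrite nth_cat size_br (leq_trans lt_j le_il).
exists (Node l r), Leaf; split=> //=; apply/eqP; rewrite eqn_leq le_i andbT.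
by have := H _ lt_li; rewrite nth_cat size_br ltnn subnn.
Qed.

Lemma over_leftmost l r : exists t1 t2, Node l r = over (Node Leaf t1) t2.
Proof.
elim: l r => [|l1 IH l2 _] r; first by exists r, Leaf.
by have [t1 [t2 ->]] := IH l2; exists t1, (Node t2 r).
Qed.

(** The first entry [a] belongs to the leftmost node: the next [a] entries are its right subtree,
    and the remaining ones the tree on which it is grafted. *)
Lemma bvalid_brP v : bvalid v -> exists t, br t = v.
Proof.
have [n] := ubnP (size v); elim: n v => // n IH [|a v] /=; first by exists Leaf.
rewrite ltnS => lt_v /and3P[le_a /allP av vv].
have [||t1 t1E] := IH (take a v).
- by rewrite size_take_min (leq_ltn_trans _ lt_v) ?geq_minr.
- by apply: bvalid_take => // i lt_i; apply: av; rewrite mem_iota.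
have [|t2 t2E] := IH (drop a v) _ (bvalid_drop a vv).
  by rewrite size_drop (leq_ltn_trans _ lt_v) ?leq_subr.
exists (over (Node Leaf t1) t2).
by rewrite br_over /= t1E t2E cat_take_drop -size_br t1E size_takel.
Qed.

Lemma all2_leq_refl v : all2 leq v v.
Proof. by elim: v => //= a v ->; rewrite leqnn. Qed.

Lemma all2_leq_trans v1 v2 v3 : all2 leq v1 v2 -> all2 leq v2 v3 -> all2 leq v1 v3.
Proof.
elim: v1 v2 v3 => [|a v1 IH] [|b v2] [|c v3] //= /andP[ab h1] /andP[bc h2].
by rewrite (leq_trans ab bc) (IH v2).
Qed.

Lemma all2_leq_cat u1 u2 v1 v2 :
  size u1 = size u2 -> all2 leq (u1 ++ v1) (u2 ++ v2) = all2 leq u1 u2 && all2 leq v1 v2.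
Proof. by elim: u1 u2 => [|a u1 IH] [|b u2] //= [/IH->]; rewrite andbA. Qed.

Lemma all2_leq_size u v : all2 leq u v -> size u = size v.
Proof. by rewrite all2E => /andP[/eqP]. Qed.

Lemma all2_leq_nth u v i : all2 leq u v -> nth 0 u i <= nth 0 v i.
Proof. by elim: u v i => [|a u IH] [|b v] [|i] //= /andP[? ?]; rewrite ?IH. Qed.

(** A rotation changes a single entry: the bracket of the left child grows past its parent to
    include the parent's right subtree. The strict growth of the sum gives antisymmetry later. *)
Lemma rot1_br t u : u \in rot1 t ->
  all2 leq (br t) (br u) /\ sumn (br t) < sumn (br u).
Proof.
elim: t u => //= l IHl r IHr u; rewrite !mem_cat => /or3P[].
- case: l {IHl} => //= a b; rewrite inE => /eqP-> /=.
  rewrite -!catA !cat_cons all2_leq_cat // all2_leq_refl /= all2_leq_refl.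
  by rewrite !sumn_cat /= !sumn_cat /=; split; lia.
- case/mapP => l' /IHl[le_l lt_l] -> /=.
  rewrite all2_leq_cat ?(all2_leq_size le_l) // le_l /= leqnn all2_leq_refl.
  by rewrite !sumn_cat ltn_add2r.
case/mapP => r' /IHr[le_r lt_r] -> /=.
rewrite all2_leq_cat // all2_leq_refl /= le_r -!size_br (all2_leq_size le_r) leqnn.
by rewrite !sumn_cat /= ltn_add2l ltn_add2l.
Qed.

Lemma tamari_le_br t u : tamari_le t u ->
  all2 leq (br t) (br u) /\ (t = u \/ sumn (br t) < sumn (br u)).
Proof.
elim=> {t u} [t u /rot1_br[]|t|t u v _ [le1 h1] _ [le2 h2]].
- by split; [|right].
- by split; [exact: all2_leq_refl|left].
split; first exact: all2_leq_trans le1 le2.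
case: h1 h2 => [->|lt1] [<-|lt2]; try by [left|right].
by right; apply: ltn_trans lt1 lt2.
Qed.

Lemma tamari_le_trans t u v : tamari_le t u -> tamari_le u v -> tamari_le t v.
Proof. exact: rt_trans. Qed.

Lemma tamari_le_refl t : tamari_le t t.
Proof. exact: rt_refl. Qed.

Lemma tamari_le_antisym t u : tamari_le t u -> tamari_le u t -> t = u.
Proof.
move=> /tamari_le_br[_ [//|lt1]] /tamari_le_br[_ [//|lt2]].
by have := ltn_trans lt1 lt2; rewrite ltnn.
Qed.

Lemma tamari_Node_l l l' r : tamari_le l l' -> tamari_le (Node l r) (Node l' r).
Proof.
elim=> {l l'} [l l' h|l|l1 l2 l3 _ h1 _ h2]; last exact: tamari_le_trans h1 h2.
  by apply: rt_step; rewrite /rot_step /= !mem_cat; apply/or3P/Or32/map_f.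
exact: tamari_le_refl.
Qed.

Lemma tamari_Node_r l r r' : tamari_le r r' -> tamari_le (Node l r) (Node l r').
Proof.
elim=> {r r'} [r r' h|r|r1 r2 r3 _ h1 _ h2]; last exact: tamari_le_trans h1 h2.
  by apply: rt_step; rewrite /rot_step /= !mem_cat; apply/or3P/Or33/map_f.
exact: tamari_le_refl.
Qed.

Lemma tamari_over_l x x' t : tamari_le x x' -> tamari_le (over x t) (over x' t).
Proof. by move=> h; elim: t => //= l IHl r _; apply: tamari_Node_l. Qed.

Lemma tamari_over_r x t t' : tamari_le t t' -> tamari_le (over x t) (over x t').
Proof.
elim=> {t t'} [t t' h|t|t1 t2 t3 _ h1 _ h2]; last exact: tamari_le_trans h1 h2.
  elim: t t' h => //= l IHl r _ t'; rewrite /rot_step /= !mem_cat => /or3P[].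
  - case: l {IHl} => //= a b; rewrite inE => /eqP->.
    by apply: rt_step; rewrite /rot_step /= inE eqxx.
  - by case/mapP => l' h ->; apply: tamari_Node_l; apply: IHl.
  by case/mapP => r' h ->; apply: tamari_Node_r; apply: rt_step.
exact: tamari_le_refl.
Qed.

(** One rotation for each node on the left spine of [t2]. *)
Lemma tamari_over_Node t1 t2 :
  tamari_le (over (Node Leaf t1) t2) (Node Leaf (over t1 t2)).
Proof.
elim: t2 => [|l IHl r _] /=; first exact: tamari_le_refl.
apply: tamari_le_trans (tamari_Node_l r IHl) _.
by apply: rt_step; rewrite /rot_step /= inE eqxx.
Qed.

(** Induction on the size of [u], moving [t] up until its root matches that of [u] and comparing the
    pieces. *)
Lemma br_tamari_le t u : all2 leq (br t) (br u) -> tamari_le t u.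
Proof.
have [n] := ubnP (nodes u); elim: n t u => // n IH t [|l r].
  by case: t => [|a b] _ => [_|/all2_leq_size]; [exact: tamari_le_refl|rewrite !size_br].
rewrite ltnS /= => lt_n le_t.
have szt : nodes t = (nodes l + nodes r).+1.
  by rewrite -size_br (all2_leq_size le_t) size_cat /= !size_br addnS.
have [l0|l_gt0] := posnP (nodes l).
  case: l l0 lt_n le_t szt => //= _ lt_n.
  case: t => //= a b; have [t1 [t2 tE]] := over_leftmost a b.
  have -> : br a ++ nodes b :: br b = br (over (Node Leaf t1) t2) by rewrite -tE.
  rewrite tE br_over /= => /andP[_ le_t] _.
  (* The first bracket of [u] is maximal, so the leftmost node of [t] can be rotated up to the
     root. *)
  apply: tamari_le_trans (tamari_over_Node t1 t2) _.
  apply: tamari_Node_r; apply: IH => //; last by rewrite br_over.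
have [||t1 [t2 [tE szt1]]] := @over_split t (nodes l).
- by rewrite szt -addnS leq_addr.
(* In [u] no bracket crosses the end of [l], so none does in [t], whose brackets are smaller. *)
- move=> j lt_j; have := all2_leq_nth j le_t; rewrite nth_cat size_br lt_j.
  have := bvalid_lt (bvalid_br l); rewrite size_br => /(_ _ lt_j) h1 h2.
  by apply: leq_ltn_trans h1; rewrite leq_add2l.
move: le_t; rewrite tE br_over all2_leq_cat ?size_br // => /andP[le1 le2].
have h1 : tamari_le t1 l by apply: (IH _ _ _ le1); lia.
have h2 : tamari_le t2 (Node Leaf r) by apply: (IH t2 (Node Leaf r) _ le2) => /=; lia.
exact: tamari_le_trans (tamari_over_l t2 h1) (tamari_over_r l h2).
Qed.

Lemma tamari_lebP t u : reflect (tamari_le t u) (tamari_leb t u).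
Proof. by rewrite /tamari_leb; case: excluded_middle_informative => h; constructor. Qed.

Lemma tamari_lebE t u : tamari_leb t u = all2 leq (br t) (br u).
Proof.
by apply/tamari_lebP/idP => [/tamari_le_br[]|/br_tamari_le].
Qed.

Lemma br_inj : injective br.
Proof.
by move=> t u e; apply: tamari_le_antisym; apply: br_tamari_le; rewrite e all2_leq_refl.
Qed.

Lemma tamari_leb_refl t : tamari_leb t t.
Proof. by rewrite tamari_lebE all2_leq_refl. Qed.

Lemma tamari_leb_trans t u v : tamari_leb t u -> tamari_leb u v -> tamari_leb t v.
Proof. by rewrite !tamari_lebE; apply: all2_leq_trans. Qed.

Lemma tamari_leb_antisym t u : tamari_leb t u -> tamari_leb u t -> t = u.
Proof. by move=> /tamari_lebP h /tamari_lebP; apply: tamari_le_antisym. Qed.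

(** * Bracket vectors of shuffled words *)

(* The bracket vector of the decreasing binary tree of a word: each letter
   counts the smaller letters immediately to its right. *)
Fixpoint brw (w : seq nat) : seq nat :=
  if w is a :: w' then find (leq a) w' :: brw w' else [::].

Lemma size_brw w : size (brw w) = size w.
Proof. by elim: w => //= a w ->. Qed.

(** [M] stops the count of every letter of [u], and nothing in [v] stops that of [M]. *)
Lemma brw_cat_max u M v :
  (forall a, a \in u -> a <= M) -> (forall a, a \in v -> a < M) ->
  brw (u ++ M :: v) = brw u ++ size v :: brw v.
Proof.
move=> leu ltv; elim: u leu => [_|a u IH leu] /=.
  congr (_ :: _); apply/hasNfind/hasPn => a /ltv; lia.
rewrite IH => [|b b_u]; last by apply: leu; rewrite inE b_u orbT.
congr (_ :: _); rewrite find_cat /= leu ?mem_head // addn0.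
by case: ifPn => // /hasNfind.
Qed.

Lemma brw_map f w :
  {in w &, forall a b, (f a <= f b) = (a <= b)} -> brw (map f w) = brw w.
Proof.
elim: w => //= a w IH f_mono; congr (_ :: _); last first.
  by apply: IH => b c bw cw; apply: f_mono; rewrite inE ?bw ?cw orbT.
rewrite find_map; apply: eq_in_find => b bw /=.
by apply: f_mono; rewrite inE ?eqxx ?bw ?orbT.
Qed.

Lemma size_gam t : size (gam t) = nodes t.
Proof.
by elim: t => //= l IHl r IHr; rewrite /pvee size_cat /= size_map IHl IHr addnS.
Qed.

Lemma perm_gam t : perm_eq (gam t) (iota 1 (nodes t)).
Proof.
elim: t => // l IHl r IHr; rewrite [gam _]/= /pvee !size_gam.
have -> : nodes (Node l r) = nodes r + (nodes l + 1) by rewrite /=; lia.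
apply/permP => P; rewrite !iotaD !count_cat /=.
rewrite (permP IHr) (permP (perm_map _ IHl)).
have -> : iota (1 + nodes r) (nodes l) = [seq x + nodes r | x <- iota 1 (nodes l)].
  by rewrite addnC iotaDl; apply: eq_map => x; rewrite addnC.
by rewrite -[1 + _ + _]addnA add1n [nodes r + _]addnC addn0 addnA addnC.
Qed.

Lemma mem_gam t a : (a \in gam t) = (0 < a <= nodes t).
Proof. by rewrite (perm_mem (perm_gam t)) mem_iota add1n ltnS. Qed.

Lemma brw_gam t : brw (gam t) = br t.
Proof.
elim: t => //= l IHl r IHr; rewrite /pvee brw_cat_max.
- by rewrite brw_map ?IHl ?IHr ?size_gam // => a b _ _; rewrite leq_add2r.
- by move=> _ /mapP[a ain ->]; move: ain; rewrite mem_gam !size_gam; lia.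
by move=> a; rewrite mem_gam !size_gam; lia.
Qed.

Lemma st_mono a :
  {in a &, forall x y, ((count (ltn^~ x) a).+1 <= (count (ltn^~ y) a).+1) = (x <= y)}.
Proof.
move=> x y xa ya; rewrite ltnS; have [le_xy|lt_yx] := leqP x y.
  by apply: sub_count => z /= /leq_trans->.
apply/negbTE; rewrite -ltnNge -[X in _ < X]size_filter.
rewrite -(count_predC (ltn^~ y)) !count_filter; apply: leq_trans (_ : count (ltn^~ y) a + 1 <= _).
  by rewrite addn1.
apply: leq_add; first by apply: sub_count => z /= h; rewrite h (ltn_trans h lt_yx).
by rewrite -has_count; apply/hasP; exists y => //=; rewrite lt_yx ltnn.
Qed.

Lemma size_st a : size (st a) = size a.
Proof. exact: size_map. Qed.

Lemma brw_st a : brw (st a) = brw a.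
Proof. by apply: brw_map; apply: st_mono. Qed.

Lemma perm_st a : uniq a -> perm_eq (st a) (iota 1 (size a)).
Proof.
move=> ua; have ust : uniq (st a).
  rewrite map_inj_in_uniq // => x y xa ya e.
  by apply/eqP; rewrite eqn_leq -!(st_mono xa ya) -!(st_mono ya xa) e leqnn.
apply: uniq_perm; rewrite ?iota_uniq //.
have sub : {subset st a <= iota 1 (size a)}.
  move=> _ /mapP[x xa ->]; rewrite mem_iota /= add1n ltnS.
  rewrite -(count_predC (ltn^~ x) a) -addn1 leq_add2l -has_count.
  by apply/hasP; exists x => //=; rewrite ltnn.
by have [|_] := uniq_min_size ust sub; rewrite ?size_iota ?size_st.
Qed.

(** [lam] cuts at the maximum, where [brw_cat_max] cuts the bracket vector; standardizing the two
    sides changes no comparison. *)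
Lemma br_lam_aux k s :
  size s <= k -> perm_eq s (iota 1 (size s)) -> br (lam_aux k s) = brw s.
Proof.
elim: k s => [|k IH] [|a0 s0] // le_k ps; set s := a0 :: s0 in le_k ps *.
have n_s : size s \in s by rewrite (perm_mem ps) mem_iota /=.
have us : uniq s by rewrite (perm_uniq ps) iota_uniq.
have le_s a : a \in s -> a <= size s by rewrite (perm_mem ps) mem_iota; lia.
pose j := index (size s) s.
have lt_j : j < size s by rewrite index_mem.
have sE : s = take j s ++ size s :: drop j.+1 s.
  by rewrite -{1}(cat_take_drop j s) (drop_nth 0 lt_j) nth_index.
have -> : br (lam_aux k.+1 s) =
  br (lam_aux k (st (take j s))) ++ nodes (lam_aux k (st (drop j.+1 s)))
   :: br (lam_aux k (st (drop j.+1 s))) by [].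
rewrite -size_br !IH ?brw_st ?size_brw ?size_st.
- rewrite [in RHS]sE brw_cat_max // => a; first by move/mem_take/le_s.
  move=> ain; rewrite ltn_neqAle le_s ?(mem_drop ain) // andbT.
  apply: contraTneq ain => ->; move: us; rewrite {1}sE cat_uniq /= => /and3P[_ _].
  by case/andP.
- by rewrite size_drop leq_subLR addSn (leq_trans le_k) // ltnS leq_addl.
- by apply: perm_st; apply: drop_uniq.
- by rewrite size_take_min geq_min -ltnS (leq_trans lt_j).
by apply: perm_st; apply: take_uniq.
Qed.

Lemma br_lam s : perm_eq s (iota 1 (size s)) -> br (lam s) = brw s.
Proof. exact: br_lam_aux. Qed.

(* The shuffle of [x] and [y] whose letters from [y] sit at the [true]s of [m]. *)
Fixpoint inter (m : bitseq) (x y : seq nat) : seq nat :=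
  if m is b :: m' then
    if b then head 0 y :: inter m' x (behead y)
    else head 0 x :: inter m' (behead x) y
  else [::].

(* Position of the [k]-th [true] (from 0), or [size m] if there is none. *)
Fixpoint truepos (m : bitseq) (k : nat) : nat :=
  if m is b :: m' then
    if b then (if k is k'.+1 then (truepos m' k').+1 else 0)
    else (truepos m' k).+1
  else 0.

Fixpoint bmerge (m : bitseq) (u v : seq nat) : seq nat :=
  if m is b :: m' then
    if b then truepos m' (head 0 v) :: bmerge m' u (behead v)
    else minn (head 0 u) (find id m') :: bmerge m' (behead u) v
  else [::].

Lemma size_inter m x y : size (inter m x y) = size m.
Proof. by elim: m x y => //= -[] m IH x y /=; rewrite IH. Qed.

(** Any letter of [y] stops [a], and the word agrees with [x] up to the first [true]. *)
Lemma find_inter_low m x y a :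
  count negb m = size x -> count id m = size y -> (forall b, b \in y -> a < b) ->
  find (leq a) (inter m x y) = minn (find (leq a) x) (find id m).
Proof.
elim: m x y => [|[] m IH] x y /=; rewrite ?(add0n, add1n).
- by case: x => //; rewrite min0n.
- by case: y => // b y _ _ /= lt_a; rewrite minn0 ltnW ?lt_a ?mem_head.
case: x => //= c x [szx] szy lt_a; case: leqP => _; first by rewrite min0n.
by rewrite IH // minnSS.
Qed.

(** Only letters of [y] can stop [b]; [truepos] turns the index of such a letter in [y] into its
    position in the word. *)
Lemma find_inter_high m x y b :
  count negb m = size x -> count id m = size y -> (forall a, a \in x -> a < b) ->
  find (leq b) (inter m x y) = truepos m (find (leq b) y).
Proof.
elim: m x y => [|[] m IH] x y //=; rewrite ?(add0n, add1n).
  by case: y => //= c y szx [szy] lt_b; case: leqP => // _; rewrite IH.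
case: x => //= c x [szx] szy lt_b; rewrite leqNgt lt_b ?mem_head //= IH //.
by move=> a ain; apply: lt_b; rewrite inE ain orbT.
Qed.

Lemma brw_inter m x y :
  count negb m = size x -> count id m = size y ->
  (forall a b, a \in x -> b \in y -> a < b) ->
  brw (inter m x y) = bmerge m (brw x) (brw y).
Proof.
elim: m x y => [|[] m IH] x y //=; rewrite ?(add0n, add1n).
  case: y => //= b y szx [szy] lt_xy; rewrite IH //; last first.
    by move=> a c ain cin; apply: lt_xy; rewrite // inE cin orbT.
  by rewrite find_inter_high // => a ain; apply: lt_xy; rewrite // mem_head.
case: x => //= a x [szx] szy lt_xy; rewrite IH //; last first.
  by move=> c b cin bin; apply: lt_xy; rewrite // inE cin orbT.
by rewrite find_inter_low // => b bin; apply: lt_xy; rewrite // mem_head.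
Qed.

(** * Largest bracket vectors below a given bound *)

(* [projS m R] and [projT m R] are the largest vectors [u] and [v] such that
   [bmerge m u v <= R]; such vectors exist exactly when [feas m R] holds. The
   bound on a letter of [s] disappears when [R] reaches the next letter of [t].
   In [projT] the appended [true] stands for the end of the word. *)
Fixpoint projS (m : bitseq) (R : seq nat) : seq nat :=
  if m is b :: m' then
    if b then projS m' (behead R)
    else (if find id m' <= head 0 R then count negb m' else head 0 R)
           :: projS m' (behead R)
  else [::].

Fixpoint projT (m : bitseq) (R : seq nat) : seq nat :=
  if m is b :: m' then
    if b then (count id (take (head 0 R).+1 (rcons m' true))).-1 :: projT m' (behead R)
    else projT m' (behead R)
  else [::].

Fixpoint feas (m : bitseq) (R : seq nat) : bool :=
  if m is b :: m' then (b ==> (find id m' <= head 0 R)) && feas m' (behead R)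
  else true.

Lemma size_projS m R : size (projS m R) = count negb m.
Proof. by elim: m R => //= -[] m IH R /=; rewrite IH. Qed.

Lemma size_projT m R : size (projT m R) = count id m.
Proof. by elim: m R => //= -[] m IH R /=; rewrite IH. Qed.

(** The appended [true] covers the case [k = count id m], where [truepos m k] is the end of the
    word. *)
Lemma truepos_le m k r : k <= count id m ->
  (truepos m k <= r) = (k < count id (take r.+1 (rcons m true))).
Proof.
elim: m k r => [|[] m IH] k r /=; rewrite ?(add0n, add1n).
- by rewrite leqn0 => /eqP->.
- by case: k r => [|k] [|r] //=; rewrite ?take0 // ltnS => /IH h; rewrite ltnS h.
by case: r => [|r] le_k; rewrite ?take0 //= ltnS IH.
Qed.

Lemma truepos0 m : truepos m 0 = find id m.
Proof. by elim: m => //= -[] m //= ->. Qed.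

Lemma bmerge_le m u v R :
  size R = size m -> size u = count negb m -> size v = count id m ->
  bvalid u -> bvalid v ->
  all2 leq (bmerge m u v) R =
    [&& feas m R, all2 leq u (projS m R) & all2 leq v (projT m R)].
Proof.
elim: m u v R => [|[] m IH] u v [|r R] //=; rewrite ?(add0n, add1n).
- by move=> _ /size0nil-> /size0nil->.
- case: v => //= b v [szR] szu [szv] vu /and3P[le_b _ vv].
  (* Reading [find id m] as [truepos m 0] makes feasibility say that the count in [projT] is
     positive, so that its predecessor is an exact bound. *)
  rewrite IH // truepos_le -?szv // -truepos0 truepos_le //.
  case: (count id _) => [|n] //=; rewrite ltnS.
  by case: (feas _ _); case: (all2 _ u _); case: (b <= n); rewrite /= ?andbF.
case: u => //= a u [szR] [szu] szv /and3P[le_a _ vu] vv.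
rewrite IH // andbCA; congr (_ && _); rewrite -andbA; congr (_ && _).
(* Once [r] reaches the next [true], the only bound left on [a] is the one given by validity. *)
rewrite geq_min -szu; case: (leqP (find id m) r) => _; first by rewrite orbT le_a.
by rewrite orbF.
Qed.

Lemma projS_nth m R i :
  i < find id m -> nth 0 R i < find id m - i.+1 -> nth 0 (projS m R) i = nth 0 R i.
Proof.
elim: m R i => [|[] m IH] [|r R] [|i] //=; rewrite ?ltnS ?subn1 ?subSS //=.
- by case: (find id m).
- by move=> h1 h2; have := IH [::] i h1; rewrite nth_nil => ->.
- by move=> _; rewrite [find id m <= r]leqNgt => ->.
by move=> *; apply: IH.
Qed.

(** A bracket reaching the next [true] is replaced by one spanning everything left. Any other stays
    before that [true], where [projS_nth] carries over the nesting of [R]. *)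
Lemma bvalid_projS m R : size R = size m -> bvalid R -> bvalid (projS m R).
Proof.
elim: m R => [|[] m IH] [|r R] //= [szR] /and3P[le_r /allP rR vR]; first exact: IH.
have vS := IH R szR vR; rewrite vS andbT size_projS; case: (leqP (find id m) r) => lt_r.
  by rewrite -(size_projS m R); have /and3P[-> ->] := bvalid_cons_size vS.
have r_le : r <= count negb m.
  apply: leq_trans (ltnW lt_r) _; by elim: (m) => //= -[].
rewrite r_le; apply/allP => i i_in; have := rR i i_in; move: i_in.
rewrite mem_iota /= => lt_i lt_R; rewrite projS_nth //; lia.
Qed.

Lemma projT_nth m R i : i < count id m ->
  nth 0 (projT m R) i =
  (count id (take (nth 0 R (truepos m i)).+1 (drop (truepos m i).+1 (rcons m true)))).-1.
Proof.
elim: m R i => [|[] m IH] R [|i] //=; rewrite ?(add0n, add1n).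
- by rewrite drop0 nth0.
- by rewrite ltnS => /IH->; rewrite nth_behead.
- by move=> /IH->; rewrite nth_behead.
by move=> /IH->; rewrite nth_behead.
Qed.

Lemma count_truepos m i : i < count id m ->
  count id (take (truepos m i).+1 (rcons m true)) = i.+1.
Proof.
elim: m i => [|[] m IH] [|i] //=; rewrite ?(add0n, add1n) ?take0 //.
- by rewrite ltnS => /IH->.
- by move/IH->.
by move/IH->.
Qed.

(** A [true] spanned by the first bracket sits at a position [j < r]; its span in [R] ends by [r],
    and counting the [true]s up to there gives the nesting. *)
Lemma bvalid_projT m R : size R = size m -> bvalid R -> bvalid (projT m R).
Proof.
elim: m R => [|[] m IH] [|r R] //= [szR] /and3P[le_r /allP rR vR]; last exact: IH.
rewrite IH // andbT size_projT; set N := count id (take _ _).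
have le_N : N.-1 <= count id m.
  have : N <= count id (rcons m true).
    by rewrite -[X in _ <= count id X](cat_take_drop r.+1) count_cat leq_addr.
  by rewrite -cats1 count_cat /=; lia.
rewrite le_N; apply/allP => i; rewrite mem_iota /= add0n => lt_i.
have lt_ic : i < count id m by apply: leq_trans lt_i le_N.
rewrite projT_nth //; set j := truepos m i; set c := count id _.
(* [N] counts over [r.+1] letters; dropping the last one loses at most one [true], which the
   predecessor in [i < N.-1] allows for. *)
have lt_jr : j < r.
  case: (r) @N lt_i {le_r rR le_N} => [|r'] N lt_i.
    move: lt_i; rewrite /N; case: (rcons m true) => //= b s.
    by rewrite take0 addn0; case: b.
  have lt1 : i < count id (take r'.+1 (rcons m true)).
    move: lt_i; rewrite /N -[r'.+2]addn1 takeD count_cat.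
    have := count_size id (take 1 (drop r'.+1 (rcons m true))).
    by rewrite size_take_min; lia.
  by rewrite ltnS -/j /j truepos_le // ltnW.
have := rR j; rewrite mem_iota /= add0n lt_jr => /(_ isT) lt_R.
have : i.+1 + c <= N.
  rewrite -(count_truepos lt_ic) -/j /c -count_cat -takeD /N.
  rewrite -[in X in _ <= X](subnKC (_ : j.+1 + (nth 0 R j).+1 <= r.+1)); last by lia.
  by rewrite [in X in _ <= X]takeD count_cat leq_addr.
by lia.
Qed.

(** * Shuffles, multisets and the product of the fundamental basis *)

(* A non-increasing multiset [ms] of leaves of a tree with [p] nodes, as the word
   having its [true]s after [i] [false]s for each [i] in [ms]. *)
Fixpoint msmask (p : nat) (ms : seq nat) : bitseq :=
  if ms is i :: ms' then msmask i ms' ++ true :: nseq (p - i) false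
  else nseq p false.

Lemma mem_msets q hi ms :
  (ms \in msets q hi) = (size ms == q) && path geq hi ms.
Proof.
elim: q hi ms => [|q IH] hi ms; first by rewrite inE -size_eq0; case: ms.
apply/flatten_mapP/idP => [[i]|].
  rewrite mem_iota /= add0n ltnS => le_i /mapP[l].
  by rewrite IH => /andP[/eqP sz pl] -> /=; rewrite sz eqxx le_i.
case: ms => //= i ms /andP[/eqP[sz] /andP[le_i pm]].
exists i; first by rewrite -/(iota 0 hi.+1) mem_iota add0n ltnS.
by rewrite map_f // IH sz eqxx.
Qed.

Lemma msets_uniq q hi : uniq (msets q hi).
Proof.
elim: q hi => //= q IH hi.
apply: (@allpairs_uniq_dep _ _ _ (fun i l => i :: l) (iota 0 hi.+1) (msets q)).
- exact: iota_uniq.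
- by move=> i _; apply: IH.
by move=> [i l] [j k] _ _ [-> ->].
Qed.

Lemma count_negb_nseq k : count negb (nseq k false) = k.
Proof. by rewrite count_nseq /= mul1n. Qed.

Lemma count_id_nseq k : count id (nseq k false) = 0.
Proof. by rewrite count_nseq /= mul0n. Qed.

Lemma msmask_negb p ms : path geq p ms -> count negb (msmask p ms) = p.
Proof.
elim: ms p => [|i ms IH] p /=; first by rewrite count_negb_nseq.
by case/andP=> le_i /IH e; rewrite count_cat e /= count_negb_nseq; lia.
Qed.

Lemma msmask_id p ms : count id (msmask p ms) = size ms.
Proof.
elim: ms p => [|i ms IH] p /=; first by rewrite count_id_nseq.
by rewrite count_cat IH /= count_id_nseq; lia.
Qed.

Lemma count_negb_id m : count negb m + count id m = size m.
Proof. by rewrite addnC -(count_predC id m); congr (_ + _); apply: eq_count => b. Qed.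

Lemma size_msmask p ms : path geq p ms -> size (msmask p ms) = p + size ms.
Proof. by move=> h; rewrite -count_negb_id msmask_negb // msmask_id. Qed.

(** Inverse of [msmask] up to [rev], as it reads the multiset in increasing order; [c] is the number
    of [false]s already passed. *)
Fixpoint maskms (c : nat) (m : bitseq) : seq nat :=
  if m is b :: m' then if b then c :: maskms c m' else maskms c.+1 m' else [::].

Lemma maskms_cat c m1 m2 :
  maskms c (m1 ++ m2) = maskms c m1 ++ maskms (c + count negb m1) m2.
Proof.
by elim: m1 c => [|[] m1 IH] c /=; rewrite ?IH ?addn0 ?add0n // add1n addSnnS.
Qed.

Lemma msmaskK p ms : path geq p ms -> maskms 0 (msmask p ms) = rev ms.
Proof.
have nil_nseq c k : maskms c (nseq k false) = [::] by elim: k c => /=.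
elim: ms p => [|i ms IH] p //= /andP[le_i pm].
by rewrite maskms_cat IH // /= nil_nseq msmask_negb // rev_cons cats1.
Qed.

Lemma msmaskS p ms : path geq p ms -> msmask p.+1 ms = rcons (msmask p ms) false.
Proof.
have nseqS k : nseq k.+1 false = rcons (nseq k false) false.
  by elim: k => //= k {1}<-.
case: ms => [|i ms] /=; first by rewrite -nseqS.
by case/andP=> le_i _; rewrite subSn // rcons_cat /= -nseqS.
Qed.

(** Induction from the right: a final [true] adds the largest leaf to the multiset, a final [false]
    only enlarges [p]. *)
Lemma msmask_surj m : exists2 ms,
  path geq (count negb m) ms & msmask (count negb m) ms = m.
Proof.
elim/last_ind: m => [|m b [ms pm mE]]; first by exists [::].
rewrite -cats1 count_cat /= addn0; case: b => /=; rewrite ?addn0 ?addn1.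
  by exists (count negb m :: ms); rewrite /= ?leqnn ?subnn ?mE.
exists ms; last by rewrite msmaskS // mE cats1.
by case: ms pm {mE} => //= i ms /andP[h ->]; rewrite andbT leqW.
Qed.

(** Sends the first indices to the positions of the letters of [s] and the others to those of [t],
    so that composing with its inverse shuffles according to [m]. *)
Definition zeta_of (m : bitseq) : seq nat :=
  mask (map negb m) (iota 1 (size m)) ++ mask m (iota 1 (size m)).

Lemma size_zeta_negb m : size (mask (map negb m) (iota 1 (size m))) = count negb m.
Proof. by rewrite size_mask ?size_map ?size_iota // count_map; apply: eq_count. Qed.

Lemma perm_mask_negb (T : eqType) m (s : seq T) :
  size m = size s -> perm_eq (mask (map negb m) s ++ mask m s) s.
Proof.
elim: m s => [|[] m IH] [|x s] //= [sz]; last by rewrite perm_cons IH.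
apply: perm_trans (_ : perm_eq (x :: (mask [seq ~~ i | i <- m] s ++ mask m s)) _).
  by rewrite -cat1s perm_catCA.
by rewrite perm_cons IH.
Qed.

Lemma zeta_of_inj p m1 m2 :
  count negb m1 = p -> count negb m2 = p -> size m1 = size m2 ->
  zeta_of m1 = zeta_of m2 -> m1 = m2.
Proof.
move=> c1 c2 sz e.
have maskE m : m = [seq x \in mask m (iota 1 (size m)) | x <- iota 1 (size m)].
  apply: (@eq_from_nth _ false) => [|i lt_i]; first by rewrite size_map size_iota.
  rewrite (nth_map 0) ?size_iota // in_mask ?iota_uniq // nth_iota //.
  rewrite mem_iota -(nth_iota 0 1 lt_i) index_uniq ?size_iota ?iota_uniq //.
  by rewrite nth_iota // leq_addr ltn_add2l lt_i.
have := congr1 (drop p) e; rewrite /zeta_of.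
rewrite -{1}c1 -c2 -!size_zeta_negb !drop_size_cat // => eB.
by rewrite (maskE m1) (maskE m2) eB sz.
Qed.

Lemma shuffle_perm_sorted p q A B :
  size A = p -> perm_eq (A ++ B) (iota 1 (p + q)) ->
  is_shuffle_perm p q (A ++ B) = sorted ltn A && sorted ltn B.
Proof.
move=> szA pAB; rewrite /is_shuffle_perm pAB /=.
have uAB : uniq (A ++ B) by rewrite (perm_uniq pAB) iota_uniq.
have szAB : size (A ++ B) = p + q by rewrite (perm_size pAB) size_iota.
have szB : size B = q by move: szAB; rewrite size_cat szA => /addnI.
apply/idP/andP => [/allP H|[/(sortedP 0) sA /(sortedP 0) sB]].
  have lt_nth i : i.+1 < p + q -> i.+1 != p ->
      nth 0 (A ++ B) i < nth 0 (A ++ B) i.+1.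
    move=> lt_i ne_p; have := H i; rewrite mem_iota /= add0n (negbTE ne_p) implybF.
    have -> : i < (p + q).-1 by lia.
    rewrite -leqNgt leq_eqVlt => /(_ isT)/orP[|//].
    by rewrite nth_uniq ?szAB ?(ltnW lt_i) // => /eqP; lia.
  split; apply/(sortedP 0) => i; rewrite ?szA ?szB => lt_i.
    by have := lt_nth i; rewrite !nth_cat szA lt_i (ltnW lt_i); apply; lia.
  have := lt_nth (p + i) ltac:(lia) ltac:(lia).
  rewrite -addnS !nth_cat szA [p + i < p]ltnNge [p + i.+1 < p]ltnNge !leq_addr /=.
  by rewrite !addKn.
apply/allP => i; rewrite mem_iota /= add0n => lt_i; apply/implyP.
rewrite !nth_cat szA; case: (ltnP i.+1 p) => lt_ip.
  by rewrite (ltnW lt_ip); have := sA i; rewrite szA => /(_ lt_ip) h; lia.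
case: (ltnP i p) => [|le_pi]; first by lia.
by have := sB (i - p); rewrite szB subSn // => h; have := h ltac:(lia); lia.
Qed.

Lemma zeta_of_Spq p q m :
  count negb m = p -> count id m = q -> zeta_of m \in Spq p q.
Proof.
move=> c0 c1; have sz : size m = p + q by rewrite -count_negb_id c0 c1.
have pz : perm_eq (zeta_of m) (iota 1 (p + q)).
  by rewrite -sz perm_mask_negb ?size_iota.
rewrite mem_filter mem_permutations pz andbT.
rewrite shuffle_perm_sorted ?size_zeta_negb //.
by rewrite !(sorted_mask ltn_trans) ?iota_ltn_sorted.
Qed.

(** The word [m] marks the values in the second half of [z]; both halves increase, so they are
    determined by their sets of values. *)
Lemma Spq_zeta_of p q z : z \in Spq p q ->
  exists m, [/\ count negb m = p, count id m = q & z = zeta_of m].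
Proof.
rewrite mem_filter mem_permutations => /andP[sz pz].
pose A := take p z; pose B := drop p z.
have szz : size z = p + q by rewrite (perm_size pz) size_iota.
have szA : size A = p by rewrite size_takel // szz leq_addr.
have szB : size B = q by rewrite size_drop szz addKn.
have uz : uniq z by rewrite (perm_uniq pz) iota_uniq.
have zE : A ++ B = z by apply: cat_take_drop.
move: sz; rewrite -zE shuffle_perm_sorted ?zE // => /andP[sA sB].
have uAB : uniq (A ++ B) by rewrite zE.
pose m := [seq x \in B | x <- iota 1 (p + q)].
have memz x : x \in iota 1 (p + q) = (x \in A) || (x \in B).
  by rewrite -(perm_mem pz) -zE mem_cat.
have mB : mask m (iota 1 (p + q)) = B.
  rewrite -filter_mask; apply: (irr_sorted_eq ltn_trans ltnn) => //.
    by apply: (sorted_filter ltn_trans); apply: iota_ltn_sorted.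
  by move=> x; rewrite mem_filter memz; case: (x \in B); rewrite ?orbT.
have mA : mask (map negb m) (iota 1 (p + q)) = A.
  rewrite -map_comp -filter_mask; apply: (irr_sorted_eq ltn_trans ltnn) => //.
    by apply: (sorted_filter ltn_trans); apply: iota_ltn_sorted.
  move=> x; rewrite mem_filter memz /=.
  move: uAB; rewrite cat_uniq => /and3P[_ /hasPn h _].
  by case xB: (x \in B) => /=; rewrite ?orbF //; apply/esym/negbTE/h.
have szm : size m = p + q by rewrite size_map size_iota.
exists m; split; last by rewrite /zeta_of szm mA mB zE.
  by rewrite -size_zeta_negb szm mA.
by rewrite -szB -mB size_mask // size_iota.
Qed.

(** This turns the sum over multisets of leaves in the product into a sum over shuffles. *)
Lemma perm_Spq p q :
  perm_eq [seq zeta_of (msmask p ms) | ms <- msets q p] (Spq p q).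
Proof.
apply: uniq_perm.
- rewrite map_inj_in_uniq ?msets_uniq // => ms1 ms2.
  rewrite !mem_msets => /andP[/eqP s1 p1] /andP[/eqP s2 p2] /zeta_of_inj e.
  have {}e : msmask p ms1 = msmask p ms2.
    by apply: (e p); rewrite ?msmask_negb ?size_msmask // s1 s2.
  by rewrite -[ms1]revK -(msmaskK p1) e msmaskK // revK.
- by rewrite filter_uniq ?permutations_uniq.
move=> z; apply/mapP/idP => [[ms]|].
  rewrite mem_msets => /andP[/eqP sz pm] ->.
  by apply: zeta_of_Spq; rewrite ?msmask_negb ?msmask_id.
case/Spq_zeta_of => m [c0 c1 ->]; have [ms] := msmask_surj m.
rewrite c0 => pm mE; exists ms; last by rewrite mE.
by rewrite mem_msets pm andbT -(msmask_id p) mE c1.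
Qed.

(** * The bracket vector of [f_zeta] *)

Lemma mask_inter_true m x y : count id m = size y -> mask m (inter m x y) = y.
Proof.
elim: m x y => [|[] m IH] x y /=; rewrite ?(add0n, add1n).
- by case: y.
- by case: y => //= b y [sz]; rewrite IH.
exact: IH.
Qed.

Lemma mask_inter_false m x y :
  count negb m = size x -> mask (map negb m) (inter m x y) = x.
Proof.
elim: m x y => [|[] m IH] x y /=; rewrite ?(add0n, add1n).
- by case: x.
- exact: IH.
by case: x => //= b x [sz]; rewrite IH.
Qed.

Lemma map_nth_zeta m w : size w = size m ->
  [seq nth 0 w i.-1 | i <- zeta_of m] = mask (map negb m) w ++ mask m w.
Proof.
move=> sz; rewrite map_cat !map_mask.
suff -> : [seq nth 0 w i.-1 | i <- iota 1 (size m)] = w by [].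
by rewrite -sz (iotaDl 1 0) -map_comp -[RHS](mkseq_nth 0).
Qed.

Lemma pcomp_pinv z w :
  perm_eq z (iota 1 (size w)) -> Defs.pcomp [seq nth 0 w i.-1 | i <- z] (pinv z) = w.
Proof.
move=> pz; have sz : size z = size w by rewrite (perm_size pz) size_iota.
rewrite /Defs.pcomp /pinv -map_comp sz.
transitivity [seq nth 0 w i.-1 | i <- iota 1 (size w)].
  apply/eq_in_map => i i_in /=; have iz : i \in z by rewrite (perm_mem pz).
  by rewrite (nth_map 0) ?index_mem // nth_index.
by rewrite (iotaDl 1 0) -map_comp -[RHS](mkseq_nth 0).
Qed.

Lemma perm_pslash s t :
  perm_eq (pslash (gam s) (gam t)) (iota 1 (nodes s + nodes t)).
Proof.
rewrite /pslash iotaD; apply: perm_cat; first exact: perm_gam.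
rewrite size_gam addnC iotaDl.
apply: perm_trans (perm_map _ (perm_gam t)) _.
by rewrite (eq_map (_ : _ =1 addn (nodes s))) // => x; rewrite addnC.
Qed.

Lemma br_f_zeta m s t : count negb m = nodes s -> count id m = nodes t ->
  br (f_zeta (zeta_of m) s t) =
  brw (inter m (gam s) [seq x + nodes s | x <- gam t]).
Proof.
move=> c0 c1; have sz : size m = nodes s + nodes t by rewrite -count_negb_id c0 c1.
set w := inter _ _ _; have szw : size w = size m by rewrite size_inter.
(* Composing [w] with [zeta_of m] unshuffles it; hence [w] is the permutation to which [f_zeta]
   applies [lam]. *)
have wE : [seq nth 0 w i.-1 | i <- zeta_of m] = pslash (gam s) (gam t).
  rewrite map_nth_zeta // mask_inter_true ?mask_inter_false ?size_map ?size_gam //.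
  by rewrite /pslash size_gam.
have pz : perm_eq (zeta_of m) (iota 1 (size w)).
  by rewrite szw perm_mask_negb ?size_iota.
rewrite /f_zeta -wE pcomp_pinv // br_lam // szw sz.
apply: perm_trans (perm_pslash s t); rewrite -wE perm_sym map_nth_zeta //.
exact: perm_mask_negb.
Qed.

Lemma br_f_zeta_bmerge m s t : count negb m = nodes s -> count id m = nodes t ->
  br (f_zeta (zeta_of m) s t) = bmerge m (br s) (br t).
Proof.
move=> c0 c1; rewrite br_f_zeta // brw_inter ?size_map ?size_gam //.
  by rewrite brw_map ?brw_gam // => a b _ _; rewrite leq_add2r.
by move=> a _ + /mapP[b + ->]; rewrite !mem_gam; lia.
Qed.

(** * Grafting and division as operations on words *)

(* The word [x_0 b_1 x_1 ... b_q x_q]. *)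
Fixpoint interl (xs : seq (seq nat)) (y : seq nat) : seq nat :=
  if y is b :: y' then head [::] xs ++ b :: interl (behead xs) y'
  else head [::] xs.

Lemma interl_cat xs y1 b y2 :
  interl xs (y1 ++ b :: y2) = interl xs y1 ++ b :: interl (drop (size y1).+1 xs) y2.
Proof.
elim: y1 xs => [|c y1 IH] [|x xs] //=; first by rewrite drop0.
  by rewrite IH.
by rewrite IH -catA.
Qed.

Lemma mem_interl xs y a : a \in interl xs y ->
  a \in y \/ exists2 x, x \in xs & a \in x.
Proof.
elim: y xs => [|b y IH] [|x xs] //=.
- by move=> h; right; exists x; rewrite ?mem_head.
- by rewrite !inE => /orP[->|/IH[->|[]//]]; left; rewrite ?orbT.
rewrite mem_cat inE => /or3P[h|/eqP->|/IH[h|[x' h1 h2]]].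
- by right; exists x; rewrite ?mem_head.
- by left; rewrite mem_head.
- by left; rewrite inE h orbT.
by right; exists x'; rewrite // inE h1 orbT.
Qed.

Lemma graft_aux2 t ts : (graft_aux t ts).2 = drop (nodes t).+1 ts.
Proof.
elim: t ts => [|l IHl r IHr] ts /=; first by rewrite drop1.
case: graft_aux (IHl ts) => l' ts1 /= ->.
case: graft_aux (IHr (drop (nodes l).+1 ts)) => r' ts2 /= ->.
by rewrite drop_drop; congr drop; lia.
Qed.

(** The letters of [gam t], shifted by [c], exceed all grafted letters, so the maximum of the word
    is still the root of [t] and [brw_cat_max] splits the word there. *)
Lemma br_graft_aux t ts xs c :
  map br ts = map brw xs -> (forall x a, x \in xs -> a \in x -> a <= c) ->
  br (graft_aux t ts).1 = brw (interl xs [seq a + c | a <- gam t]).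
Proof.
elim: t ts xs c => [|l IHl r IHr] ts xs c tsE le_c /=.
  by case: ts xs tsE {le_c} => [|x ts] [|y xs] //= [].
case E1: graft_aux (graft_aux2 l ts) => [l' ts1] /= ts1E.
case E2: (graft_aux r ts1) => [r' ts2] /=.
have -> : [seq a + c | a <- pvee (gam l) (gam r)] =
   [seq a + (nodes r + c) | a <- gam l] ++ (nodes l + nodes r).+1 + c
     :: [seq a + c | a <- gam r].
  rewrite /pvee map_cat /= -map_comp !size_gam; congr (_ ++ _).
  by apply: eq_map => a /=; rewrite addnA.
rewrite interl_cat size_map size_gam.
have le_c' x a : x \in drop (nodes l).+1 xs -> a \in x -> a <= c.
  by move=> /mem_drop; apply: le_c.
rewrite brw_cat_max.
- rewrite -(IHl ts) // ?E1 /=; last by move=> x a xin /(le_c _ _ xin); lia.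
  have tsE1 : map br ts1 = map brw (drop (nodes l).+1 xs).
    by rewrite ts1E map_drop tsE map_drop.
  have := IHr ts1 _ c tsE1 le_c'; rewrite E2 /= => brr.
  by rewrite -size_br brr size_brw.
- move=> a /mem_interl[/mapP[b]|[x xin ax]]; first by rewrite mem_gam => h ->; lia.
  by have := le_c _ _ xin ax; lia.
move=> a /mem_interl[/mapP[b]|[x xin ax]]; first by rewrite mem_gam => h ->; lia.
by have := le_c' _ _ xin ax; lia.
Qed.

(* The bracket vector of a prefix of length [i] of a word with brackets [v]. *)
Fixpoint cap (i : nat) (v : seq nat) : seq nat :=
  if i is i'.+1 then if v is a :: v' then minn a i' :: cap i' v' else [::]
  else [::].

Lemma size_cap i v : size (cap i v) = minn i (size v).
Proof. by elim: i v => [|i IH] [|a v] //=; rewrite ?min0n ?minn0 // IH minnSS. Qed.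

Lemma brw_take i w : brw (take i w) = cap i (brw w).
Proof.
have find_take a j v : find (leq a) (take j v) = minn (find (leq a) v) j.
  elim: v j => [|b v IH] [|j] //=; rewrite ?minn0 ?min0n //.
  by case: leqP => _; rewrite ?min0n // IH minnSS.
by elim: w i => [|a w IH] [|i] //=; rewrite IH find_take.
Qed.

Lemma brw_drop i w : brw (drop i w) = drop i (brw w).
Proof. by elim: w i => [|a w IH] [|i] //=. Qed.

Lemma cap_catl i u v : i <= size u -> cap i (u ++ v) = cap i u.
Proof. by elim: u i => [|a u IH] [|i] //= /IH->. Qed.

Lemma cap_catr i u v : bvalid u -> size u <= i ->
  cap i (u ++ v) = u ++ cap (i - size u) v.
Proof.
elim: u i => [|a u IH] i /=; first by rewrite subn0.
case/and3P => le_a _ vu; case: i => // i le_i /=.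
by rewrite IH // subSS; congr (_ :: _); apply/minn_idPl/(leq_trans le_a).
Qed.

Lemma br_split_at t i : i <= nodes t ->
  br (split_at t i).1 = cap i (br t) /\ br (split_at t i).2 = drop i (br t).
Proof.
elim: t i => [|l IHl r IHr] i /=; first by case: i.
move=> le_i; case: leqP => [le_il|lt_li].
  case: split_at (IHl i le_il) => a b /= [-> ->].
  rewrite cap_catl ?size_br //; split=> //.
  rewrite drop_cat size_br; case: ltnP => // le_li.
  have -> : i = nodes l by apply/eqP; rewrite eqn_leq le_il.
  by rewrite subnn drop0 -size_br drop_size.
have [|e1 e2] := IHr (i - (nodes l).+1); first by lia.
case: split_at e1 e2 => a b /= e1 e2.
rewrite cap_catr ?bvalid_br ?size_br ?(ltnW lt_li) //.
have -> : i - nodes l = (i - (nodes l).+1).+1 by lia.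
rewrite /= -e1; split.
  (* The root stays in the left piece, and its bracket shrinks to the size of the left part of
     [r]. *)
  congr (_ ++ _ :: _); rewrite -size_br e1 size_cap size_br; lia.
rewrite drop_cat size_br ltnNge (ltnW lt_li) /= e2.
by have -> : i - nodes l = (i - (nodes l).+1).+1 by lia.
Qed.

Fixpoint cut (w : seq nat) (ms : seq nat) : seq (seq nat) :=
  if ms is i :: ms' then rcons (cut (take i w) ms') (drop i w) else [:: w].

Lemma br_divide t w ms : br t = brw w -> path geq (size w) ms ->
  map br (divide t ms) = map brw (cut w ms).
Proof.
elim: ms t w => [|i ms IH] t w /= tE; first by rewrite tE.
case/andP=> le_i pm; have [] := @br_split_at t i.
  by rewrite -size_br tE size_brw.
case: split_at => t' tq /= e1 e2; rewrite !map_rcons e2 tE -brw_drop.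
by congr rcons; apply: IH; rewrite ?e1 ?tE ?brw_take // size_takel.
Qed.

Lemma size_cut w ms : size (cut w ms) = (size ms).+1.
Proof. by elim: ms w => //= i ms IH w; rewrite size_rcons IH. Qed.

Lemma mem_cut w ms x a : x \in cut w ms -> a \in x -> a \in w.
Proof.
elim: ms w => [|i ms IH] w /=; first by rewrite inE => /eqP->.
by rewrite mem_rcons inE => /orP[/eqP->|/IH h /h]; [exact: mem_drop|exact: mem_take].
Qed.

Lemma interl_rcons xs d y b : size xs = (size y).+1 ->
  interl (rcons xs d) (rcons y b) = interl xs y ++ b :: d.
Proof.
elim: y xs => [|c y IH] [|x xs] //= [sz]; first by case: xs sz.
by rewrite IH // -catA.
Qed.

Lemma inter_cat m1 m2 x1 x2 y1 y2 :
  count negb m1 = size x1 -> count id m1 = size y1 ->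
  inter (m1 ++ m2) (x1 ++ x2) (y1 ++ y2) = inter m1 x1 y1 ++ inter m2 x2 y2.
Proof.
elim: m1 x1 y1 => [|[] m1 IH] x1 y1 /=; rewrite ?(add0n, add1n).
- by case: x1 y1 => [|? ?] [|? ?].
- by case: y1 => //= b y1 szx [szy]; rewrite IH.
by case: x1 => //= b x1 [szx] szy; rewrite IH.
Qed.

(** Peels off the largest leaf [i]: the last letter of [y] follows the first [i] letters of [x], as
    the last [true] of [msmask] does. *)
Lemma interl_cut x ms y : path geq (size x) ms -> size y = size ms ->
  interl (cut x ms) y = inter (msmask (size x) ms) x y.
Proof.
have inter_nseq z : inter (nseq (size z) false) z [::] = z.
  by elim: z => //= a z ->.
elim: ms x y => [|i ms IH] x y /=; first by case: y => //= _ _; rewrite inter_nseq.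
case/andP=> le_i pm; case/lastP: y => // y b; rewrite size_rcons => -[szy].
rewrite interl_rcons ?size_cut ?szy // -[X in inter _ X _](cat_take_drop i x) -cats1.
have szx : size (take i x) = i by rewrite size_takel.
rewrite inter_cat ?msmask_negb ?msmask_id ?szx ?szy //= -size_drop inter_nseq.
by rewrite IH ?szx.
Qed.

(** Both trees have the bracket vector of the same shuffle of [gam s] with the shifted [gam t]. *)
Lemma graft_divide s t ms : path geq (nodes s) ms -> size ms = nodes t ->
  graft (divide s ms) t = f_zeta (zeta_of (msmask (nodes s) ms)) s t.
Proof.
move=> pm szm; apply: br_inj.
rewrite br_f_zeta ?msmask_negb ?msmask_id // -{1}size_gam.
rewrite -interl_cut ?size_map ?size_gam //; apply: br_graft_aux.
  by apply: br_divide; rewrite ?brw_gam ?size_gam.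
by move=> x a /mem_cut h /h; rewrite mem_gam => /andP[].
Qed.

Lemma Fprod_coefE s t u :
  Fprod_coef s t u =
  ((count (fun z => f_zeta z s t == u) (Spq (nodes s) (nodes t)))%:R)%R.
Proof.
rewrite /Fprod_coef -(permP (perm_Spq _ _)) count_map; congr (_%:R)%R.
apply: eq_in_count => ms; rewrite mem_msets => /andP[/eqP szm pm] /=.
by rewrite graft_divide.
Qed.

(** * Moebius inversion on trees *)

Lemma size_treesUpTo n : size (treesUpTo n) = n.+1.
Proof. by elim: n => //= n IH; rewrite size_rcons IH. Qed.

Lemma nth_treesUpTo n i : i <= n -> nth [::] (treesUpTo n) i = Y i.
Proof.
elim: n => [|n IH]; first by rewrite leqn0 => /eqP->.
rewrite leq_eqVlt => /orP[/eqP->//|]; rewrite ltnS => le_i.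
by rewrite /= nth_rcons size_treesUpTo ltnS le_i IH.
Qed.

Lemma Y_S n : Y n.+1 =
  flatten [seq [seq Node l r | l <- Y i, r <- Y (n - i)] | i <- iota 0 n.+1].
Proof.
rewrite {1}/Y /treesUpTo -/treesUpTo nth_rcons size_treesUpTo ltnn eqxx.
congr flatten; apply/eq_in_map => i; rewrite mem_iota add0n ltnS => le_i.
by rewrite !nth_treesUpTo ?leq_subr.
Qed.

Lemma mem_Y n t : (t \in Y n) = (nodes t == n).
Proof.
elim/ltn_ind: n t => -[|n] IH t; first by rewrite inE; case: t.
rewrite Y_S; apply/flatten_mapP/eqP => [[i]|].
  rewrite mem_iota add0n ltnS => le_i /allpairsP[[l r] /= [lin rin ->]] /=.
  move: lin rin; rewrite !IH //; last by rewrite ltnS leq_subr.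
  by move=> /eqP-> /eqP->; rewrite subnKC.
case: t => //= l r [sz]; exists (nodes l); first by rewrite -/(iota 0 n.+1) mem_iota; lia.
by apply: allpairs_f; rewrite IH; lia.
Qed.

Lemma Y_uniq n : uniq (Y n).
Proof.
elim/ltn_ind: n => -[|n] IH //; rewrite Y_S.
(* The identity map gives the list the shape of [allpairs_uniq_dep]; the blocks are disjoint because
   [i] is the size of the left subtree. *)
rewrite (eq_map (fun i => esym (map_id (allpairs Node (Y i) (Y (n - i)))))).
apply: (allpairs_uniq_dep (f := fun _ x => x)).
- exact: iota_uniq.
- move=> i; rewrite mem_iota add0n => lt_i; apply: allpairs_uniq.
  + by apply: IH.
  + by apply: IH; rewrite ltnS leq_subr.
  by move=> [a b] [c d] _ _ [-> ->].
move=> [i x] [j y] /allpairsPdep[i' [x' [_ h1 [-> ->]]]].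
case/allpairsPdep=> j' [y' [_ h2 [-> ->]]] /= e; move: h1 h2; rewrite -e.
case/allpairsP=> -[a b] /= [aY _ ->] /allpairsP[[c d] /= [cY _ [ac _]]].
by move: aY cY; rewrite -ac !mem_Y => /eqP<- /eqP<-.
Qed.

Local Open Scope ring_scope.

(* Strictly increasing in [y], so it bounds the fuel [mob_aux] needs. *)
Definition ival_card (Yn : seq tree) (x y : tree) : nat :=
  count (fun z => [&& tamari_leb x z, tamari_leb z y & z != y]) Yn.

Lemma ival_card_lt Yn x y z : z \in Yn -> tamari_leb x z -> tamari_leb z y -> z != y ->
  (ival_card Yn x z < ival_card Yn x y)%N.
Proof.
move=> zY xz zy ne_zy.
rewrite /ival_card -[X in (_ < X)%N]size_filter.
rewrite -(count_predC (fun w => [&& tamari_leb x w, tamari_leb w z & w != z])).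
rewrite !count_filter -addn1 leq_add //.
  apply: sub_count => w /= /and3P[xw wz ne_wz]; rewrite xw wz ne_wz /=.
  rewrite (tamari_leb_trans wz zy) /=; apply: contraNneq ne_wz => wE.
  by apply/eqP; apply: tamari_leb_antisym => //; rewrite wE.
rewrite -has_count; apply/hasP; exists z => //=.
by rewrite eqxx /= !andbF xz zy ne_zy.
Qed.

Lemma mob_aux_fuel Yn x y k k' :
  (ival_card Yn x y < k)%N -> (ival_card Yn x y < k')%N ->
  mob_aux k Yn x y = mob_aux k' Yn x y.
Proof.
elim: k k' y => // k IH [|k'] y //= lt_k lt_k'; case: eqP => // _; case: ifP => // _.
congr (- _); rewrite big_seq_cond [RHS]big_seq_cond.
apply: eq_bigr => z /andP[zY /andP[/andP[xz zy] ne_zy]].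
have := ival_card_lt zY xz zy ne_zy => lt_z.
by apply: IH; apply: leq_trans lt_z _.
Qed.

Lemma mobiusE x y : x != y -> tamari_leb x y ->
  mobius x y = - \sum_(z <- Y (nodes x) | tamari_leb x z && tamari_leb z y && (z != y))
                    mobius x z.
Proof.
move=> ne_xy xy; rewrite {1}/mobius /= (negbTE ne_xy) xy; congr (- _).
rewrite big_seq_cond [RHS]big_seq_cond.
apply: eq_bigr => z /andP[zY /andP[/andP[xz zy] ne_zy]].
apply: mob_aux_fuel; last by rewrite ltnS count_size.
apply: leq_trans (ival_card_lt zY xz zy ne_zy) _; exact: count_size.
Qed.

Lemma mobius_refl x : mobius x x = 1.
Proof. by rewrite /mobius /= eqxx. Qed.

Lemma mobius_sum n x y : x \in Y n -> y \in Y n ->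
  \sum_(z <- Y n | tamari_leb x z && tamari_leb z y) mobius x z = (x == y)%:R.
Proof.
move=> xY yY; have nx : nodes x = n by move: xY; rewrite mem_Y => /eqP.
have [<-|ne_xy] := eqVneq x y.
  rewrite big_mkcond (bigD1_seq x) ?Y_uniq //= tamari_leb_refl mobius_refl.
  rewrite big1 ?addr0 // => z ne_zx; case: ifP => // /andP[xz zx].
  by rewrite (tamari_leb_antisym xz zx) eqxx in ne_zx.
have [xy|nxy] := boolP (tamari_leb x y); last first.
  by rewrite big1 // => z /andP[xz zy]; rewrite (tamari_leb_trans xz zy) in nxy.
rewrite big_mkcond (bigD1_seq y) ?Y_uniq //= xy tamari_leb_refl /= -big_mkcondr.
rewrite mobiusE // nx addrC; apply/eqP; rewrite subr_eq0; apply/eqP.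
by apply: eq_bigl => z; rewrite andbC.
Qed.

(** Since [F_u] is the sum of the [M_r] with [u <= r], this is the coefficient of [M_r] in the
    element with [F]-coefficients [g]. *)
Definition lower_sum (n : nat) (g : tree -> rat) (r : tree) : rat :=
  \sum_(u <- Y n | tamari_leb u r) g u.

Lemma lower_sum_Mcomb n c r : r \in Y n -> lower_sum n (Mcomb_Fcoef n c) r = c r.
Proof.
move=> rY; rewrite /lower_sum /Mcomb_Fcoef.
rewrite (exchange_big_dep predT) //=.
transitivity (\sum_(x <- Y n) c x * (x == r)%:R).
  rewrite big_seq [RHS]big_seq; apply: eq_bigr => x xY.
  rewrite -(mobius_sum xY rY) big_distrr /=; apply: eq_bigl => z; exact: andbC.
rewrite (bigD1_seq r) ?Y_uniq //= eqxx mulr1 big1 ?addr0 // => x /negbTE->.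
by rewrite mulr0.
Qed.

(** [mobius_sum] says that the Möbius matrix [A] is a left inverse of the order matrix [Z]; for
    square matrices it is then two-sided, and [lower_sum n g] provides the coefficients. *)
Lemma Mcomb_surj n (g : tree -> rat) :
  exists c, forall u, u \in Y n -> g u = Mcomb_Fcoef n c u.
Proof.
pose N := size (Y n); pose e (i : 'I_N) := nth Leaf (Y n) i.
have eY i : e i \in Y n by apply: mem_nth.
have sumE (P : pred tree) F : \sum_(u <- Y n | P u) F u = \sum_(i < N | P (e i)) F (e i).
  by rewrite (big_nth Leaf) big_mkord.
pose A : 'M[rat]_N := \matrix_(i, j) if tamari_leb (e i) (e j) then mobius (e i) (e j) else 0.
pose Z : 'M[rat]_N := \matrix_(i, j) (tamari_leb (e i) (e j))%:R.
have AZ : A *m Z = 1%:M.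
  apply/matrixP => i j; rewrite !mxE.
  have := mobius_sum (eY i) (eY j); rewrite sumE.
  rewrite (nth_uniq _ _ _ (Y_uniq n)) ?ltn_ord // => <-.
  rewrite [RHS]big_mkcond; apply: eq_bigr => k _; rewrite !mxE.
  by case: (tamari_leb (e i) _); case: tamari_leb; rewrite ?(mulr1, mulr0, mul0r).
have ZA := mulmx1C AZ.
exists (lower_sum n g) => u uY.
have [k ->] : exists k, u = e k.
  have lt_k : (index u (Y n) < N)%N by rewrite index_mem.
  by exists (Ordinal lt_k); rewrite /e nth_index.
pose G : 'rV[rat]_N := \row_i g (e i).
have : (G *m Z *m A) 0 k = G 0 k by rewrite -mulmxA ZA mulmx1.
rewrite !mxE => <-; rewrite /Mcomb_Fcoef sumE [RHS]big_mkcond; apply: eq_bigr => i _.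
rewrite !mxE; case: ifP => _; last by rewrite mulr0.
congr (_ * _); rewrite /lower_sum sumE [RHS]big_mkcond; apply: eq_bigr => j _.
by rewrite !mxE; case: ifP; rewrite ?mulr1 ?mulr0.
Qed.

(** * Principal ideals and the coefficient of [M_r] *)

(** [bmerge_le] bounds [s] and [t] separately; the bounds are valid vectors, hence come from trees
    [s0] and [t0]. The first alternative is the failure of [feas]. *)
Lemma f_zeta_max p q z r : z \in Spq p q -> nodes r = (p + q)%N ->
  (forall s t, nodes s = p -> nodes t = q -> ~~ tamari_leb (f_zeta z s t) r) \/
  exists s0 t0, [/\ nodes s0 = p, nodes t0 = q &
    forall s t, nodes s = p -> nodes t = q ->
      tamari_leb (f_zeta z s t) r = tamari_leb s s0 && tamari_leb t t0].
Proof.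
case/Spq_zeta_of => m [c0 c1 ->] szr.
have szR : size (br r) = size m by rewrite size_br szr -count_negb_id c0 c1.
have fE s t : nodes s = p -> nodes t = q -> tamari_leb (f_zeta (zeta_of m) s t) r =
  [&& feas m (br r), all2 leq (br s) (projS m (br r)) & all2 leq (br t) (projT m (br r))].
  move=> ss st; rewrite tamari_lebE br_f_zeta_bmerge ?c0 ?c1 ?ss ?st //.
  by rewrite bmerge_le ?bvalid_br ?[size (br s)]size_br ?[size (br t)]size_br ?c0 ?c1.
have [feasm|nfeas] := boolP (feas m (br r)); last first.
  by left=> s t ss st; rewrite fE // (negbTE nfeas).
right; have [s0 s0E] := bvalid_brP (bvalid_projS szR (bvalid_br r)).
have [t0 t0E] := bvalid_brP (bvalid_projT szR (bvalid_br r)).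
exists s0, t0; split; rewrite -?size_br ?s0E ?t0E ?size_projS ?size_projT //.
by move=> s t ss st; rewrite fE // feasm !tamari_lebE s0E t0E.
Qed.

Lemma nodes_f_zeta p q z s t : z \in Spq p q -> nodes s = p -> nodes t = q ->
  nodes (f_zeta z s t) = (p + q)%N.
Proof.
case/Spq_zeta_of => m [c0 c1 ->] ss st.
by rewrite -size_br br_f_zeta ?ss ?st // size_brw size_inter -count_negb_id c0 c1.
Qed.

(** The indicator of a principal ideal of the product order factors, so the double sum is a product
    of two Möbius sums, each a Kronecker delta. *)
Lemma mobius_sum_max_is p q z s t r :
  z \in Spq p q -> nodes s = p -> nodes t = q -> nodes r = (p + q)%N ->
  \sum_(s' <- Y p | tamari_leb s s') \sum_(t' <- Y q | tamari_leb t t')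
     mobius s s' * mobius t t' * (tamari_leb (f_zeta z s' t') r)%:R =
  (max_is p q z r s t)%:R.
Proof.
move=> zS ss st sr; have [nle|[s0 [t0 [ss0 st0 fE]]]] := f_zeta_max zS sr.
  rewrite /max_is (negbTE (nle _ _ ss st)) big_seq_cond big1 // => s' /andP[s'Y _].
  rewrite big_seq_cond big1 // => t' /andP[t'Y _].
  by rewrite (negbTE (nle _ _ _ _)) ?mulr0 //; apply/eqP; rewrite -mem_Y.
have sY : s \in Y p by rewrite mem_Y ss.
have tY : t \in Y q by rewrite mem_Y st.
have s0Y : s0 \in Y p by rewrite mem_Y ss0.
have t0Y : t0 \in Y q by rewrite mem_Y st0.
have -> : max_is p q z r s t = (s == s0) && (t == t0).
  rewrite /max_is fE //; apply/idP/idP.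
    case/andP => /andP[ls lt] /allP/(_ s0 s0Y)/allP/(_ t0 t0Y).
    rewrite fE // !tamari_leb_refl /= => /andP[ls' lt'].
    by rewrite (tamari_leb_antisym ls ls') (tamari_leb_antisym lt lt') !eqxx.
  case/andP => /eqP-> /eqP->; rewrite !tamari_leb_refl /=.
  apply/allP => s'; rewrite mem_Y => /eqP ss'; apply/allP => t'; rewrite mem_Y => /eqP st'.
  by rewrite fE // implybb.
rewrite -mulnb natrM -(mobius_sum sY s0Y) -(mobius_sum tY t0Y).
rewrite big_distrl /= [RHS]big_mkcondr /=.
rewrite big_seq_cond [RHS]big_seq_cond; apply: eq_bigr => s' /andP[s'Y _].
move: s'Y; rewrite mem_Y => /eqP ss'.
transitivity (\sum_(t' <- Y q | tamari_leb t t')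
   (if tamari_leb s' s0 then mobius s s' * (if tamari_leb t' t0 then mobius t t' else 0) else 0)).
  rewrite big_seq_cond [RHS]big_seq_cond; apply: eq_bigr => t' /andP[].
  rewrite mem_Y => /eqP st' _; rewrite fE //.
  by case: (tamari_leb s' s0); case: (tamari_leb t' t0); rewrite ?mulr1 ?mulr0.
case: ifP => _; last by rewrite big1.
by rewrite -big_distrr /= -big_mkcondr.
Qed.

Lemma lower_sum_Mprod p q s t r :
  nodes s = p -> nodes t = q -> nodes r = (p + q)%N ->
  lower_sum (p + q) (Mprod_Fcoef s t) r = (count (fun z => max_is p q z r s t) (Spq p q))%:R.
Proof.
move=> ss st sr; rewrite /lower_sum /Mprod_Fcoef ss st exchange_big /=.
transitivity (\sum_(s' <- Y p | tamari_leb s s') \sum_(t' <- Y q | tamari_leb t t')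
   \sum_(z <- Spq p q) mobius s s' * mobius t t' * (tamari_leb (f_zeta z s' t') r)%:R).
  rewrite big_seq_cond [RHS]big_seq_cond; apply: eq_bigr => s' /andP[].
  rewrite mem_Y => /eqP ss' _; rewrite exchange_big /=.
  rewrite big_seq_cond [RHS]big_seq_cond; apply: eq_bigr => t' /andP[].
  rewrite mem_Y => /eqP st' _; rewrite -!big_distrr /=; congr (_ * _).
  transitivity (\sum_(u <- Y (p + q) | tamari_leb u r)
     \sum_(z <- Spq p q) ((f_zeta z s' t' == u)%:R : rat)).
    apply: eq_bigr => u _; rewrite Fprod_coefE ss' st' -sum1_count natr_sum big_mkcond.
    by apply: eq_bigr => z _; case: eqP.
  (* For fixed [z], exactly one [u] equals [f_zeta z s' t'], and it contributes when it lies below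
     [r]. *)
  rewrite exchange_big /= big_seq [RHS]big_seq; apply: eq_bigr => z zS.
  have fY : f_zeta z s' t' \in Y (p + q) by rewrite mem_Y (nodes_f_zeta zS).
  rewrite big_mkcond (bigD1_seq _ fY) ?Y_uniq //= eqxx big1 ?addr0; first by case: ifP.
  by move=> u /negbTE; rewrite eq_sym => ->; case: ifP.
under eq_bigr => s' _ do rewrite exchange_big /=.
rewrite exchange_big /= -sum1_count natr_sum [RHS]big_mkcond /=.
rewrite big_seq [RHS]big_seq; apply: eq_bigr => z zS.
by rewrite mobius_sum_max_is //; case: ifP.
Qed.

(** The first half keeps the second from being vacuous; the second applies [lower_sum] to both
    expansions. *)
Theorem theorem4p2 (p q : nat) (s t r : tree) :
  nodes s = p -> nodes t = q -> nodes r = (p + q)%N ->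
  (exists c : tree -> rat,
      forall u, u \in Y (p + q) -> Mprod_Fcoef s t u = Mcomb_Fcoef (p + q) c u) /\
  (forall c : tree -> rat,
      (forall u, u \in Y (p + q) -> Mprod_Fcoef s t u = Mcomb_Fcoef (p + q) c u) ->
      c r = (count (fun z => max_is p q z r s t) (Spq p q))%:R).
Proof.
move=> ss st sr; split; first exact: Mcomb_surj.
move=> c cE; have rY : r \in Y (p + q) by rewrite mem_Y sr.
rewrite -(lower_sum_Mprod ss st sr) -(lower_sum_Mcomb c rY) /lower_sum.
by rewrite big_seq_cond [RHS]big_seq_cond; apply: eq_bigr => u /andP[/cE->].
Qed.
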